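(* Let $a, b, c$ be positive real numbers with $a\le b$ and $\delta=a+b-c\in(0,1)$, and put $$\varepsilon=\left|\frac{\Gamma(c)\Gamma(-\delta)}{\Gamma(c-a)\Gamma(c-b)}\right|+2^{1-\delta}\cdot\frac{\Gamma(c)\Gamma(\delta)}{\Gamma(a)\Gamma(b)},$$ where, when $c=a$ or $c=b$, this is understood as $\varepsilon=2^{1-\delta}$. Then the following hold. (I) The image of the unit disk $\mathbb{D}$ under the mapping $z\mapsto z\,{}_2F_1(a,b;c;z)$ is contained in $S_\varepsilon(\delta)$. (II) The image of the unit disk $\mathbb{D}$ under the mapping $z\mapsto z\,{}_2F_1(a,b;c;z^2)$ is contained in $S_\varepsilon^*(\delta)$.
   Context: $\mathbb{D}=\{z\in\mathbb{C}:|z|<1\}$. For real $a,b,c$ with $c\neq 0,-1,-2,\dots$, ${}_2F_1(a,b;c;z)=\sum_{n=0}^\infty \frac{(a)_n(b)_n}{(c)_n n!}z^n$ for $|z|<1$, where $(a)_0=1$ and $(a)_n=a(a+1)\cdots(a+n-1)$ for $n\ge 1$. For $0<\alpha<1$, $S(\alpha)=\{z:|\arg z|<\pi\alpha/2\}$ is the open sector with vertex $0$ and opening angle $\pi\alpha$ (principal argument, $z\ne 0$), and $S^*(\alpha)=S(\alpha)\cup[-S(\alpha)]$. For $\varepsilon>0$, $S_\varepsilon(\alpha)=\{z\in\mathbb{C}:|z-z'|<\varepsilon\text{ for some }z'\in S(\alpha)\}$ and $S^*_\varepsilon(\alpha)=\{z\in\mathbb{C}:|z-z'|<\varepsilon\text{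 for some }z'\in S^*(\alpha)\}$. *)

(* Defs.v *)
From Stdlib Require Import Reals ZArith.
From Coquelicot Require Import Coquelicot.
Open Scope R_scope.

(* (a)_n = a (a + 1) ... (a + n - 1) *)
Fixpoint pochhammer (a : R) (n : nat) : R :=
  match n with
  | O => 1
  | S m => pochhammer a m * (a + INR m)
  end.

(* The sum of the complex series; [iota] selects its unique limit. *)
Definition hyp2F1 (a b c : R) (z : C) : C :=
  iota (T := C_CompleteNormedModule)
    (is_series (V := C_NormedModule)
       (fun n : nat =>
          (RtoC (pochhammer a n * pochhammer b n
                 / (pochhammer c n * INR (fact n))) * z ^ n)%C)).

(* Euler's integral of the second kind, convergent for x > 0. *)
Definition Gamma_integral (x : R) : R :=
  RInt_gen (V := R_CompleteNormedModule)
    (fun t : R => Rpower t (x - 1) * exp (- t))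
    (at_right 0) (Rbar_locally p_infty).

(* The number of unit steps by which x is shifted to make it positive:
   [up (- x)] is the least integer > - x, so this is 0 when x > 0, and x plus
   this number lies in (0, 1] when x <= 0. *)
Definition Gamma_shift (x : R) : nat := Z.to_nat (up (- x)).

(* Euler's integral for x > 0, continued to x <= 0, x <> 0, -1, -2, ..., by
   Gamma (x + n) = (x)_n * Gamma x.  The value at the poles is meaningless. *)
Definition Gamma (x : R) : R :=
  Gamma_integral (x + INR (Gamma_shift x)) / pochhammer x (Gamma_shift x).

(* Principal argument, in (- PI, PI]; the value at 0 is meaningless. *)
Definition Carg (z : C) : R :=
  if Rle_dec 0 (Im z) then acos (Re z / Cmod z) else - acos (Re z / Cmod z).

Definition unit_disk (z : C) : Prop := Cmod z < 1.

Definition sector (alpha : R) (z : C) : Prop :=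
  z <> 0%C /\ Rabs (Carg z) < PI * alpha / 2.

Definition double_sector (alpha : R) (z : C) : Prop :=
  sector alpha z \/ sector alpha (- z)%C.

Definition nbhd (eps : R) (A : C -> Prop) (z : C) : Prop :=
  exists z' : C, A z' /\ Cmod (z - z')%C < eps.

Definition image (f : C -> C) (A : C -> Prop) (w : C) : Prop :=
  exists z : C, A z /\ w = f z.

Definition subset (A B : C -> Prop) : Prop := forall w : C, A w -> B w.

(* The case distinction is needed because Gamma (c - a) or Gamma (c - b) is
   evaluated at a pole when c = a or c = b. *)
Definition eps_const (a b c : R) : R :=
  let delta := a + b - c in
  if Req_EM_T c a then Rpower 2 (1 - delta)
  else if Req_EM_T c b then Rpower 2 (1 - delta)
  else
    Rabs (Gamma c * Gamma (- delta) / (Gamma (c - a) * Gamma (c - b)))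
    + Rpower 2 (1 - delta) * (Gamma c * Gamma delta / (Gamma a * Gamma b)).

(* Main.v *)
Require Import Defs.
From Stdlib Require Import Reals Lra Lia ZArith.
From Coquelicot Require Import Coquelicot.
Open Scope R_scope.

(** Write F(z) for the hypergeometric function and d = a + b - c. The proof
    compares F with its singular part at 1:

      F(z) = h(z) + B (1 - z)^(-d),   B = Gamma(c) Gamma(d) / (Gamma(a) Gamma(b)).

    Since 1 - z has positive real part, B (1 - z)^(-d) lies in the sector of
    opening PI d ([binom_series_polar], [sector_polar]), and

      z F(z) - B (1 - z)^(-d) = z h(z) - B (1 - z)^(1 - d),

    whose last term has modulus less than 2^(1 - d) B. For z F(z^2) with
    Re z >= 0 the reference point is B (1 - z^2)^(-d), and
    |1 - z| |1 - z^2|^(-d) <= |1 - z|^(1 - d) because |1 + z| >= 1; for Re z < 0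
    replace z by - z ([nbhd_sectors_of_remainder]). It remains to bound h on the
    disk by A = |Gamma(c) Gamma(-d) / (Gamma(c - a) Gamma(c - b))|, and this is done
    by bounding the sum of the absolute values of its coefficients.

    Let u_n and v_n be the coefficients of F and of (1 - z)^(-d). The quotients
    t_n = u_n / v_n are monotone, because their numerator and denominator have
    n-th factors with the same sum ([coef_ratio_step]), and they converge to B
    ([pochhammer_ratio_lim]). So the coefficients v_n (t_n - B) of h have a constant
    sign, and the sum of their absolute values can be found by telescoping: it is
    at most |(c - a) (c - b) / (c d)| F(a, b; c + 1; 1) ([hyp_coef_remainder_sum]).
    Gauss's theorem, of which only the upper bound is used ([Gauss_sum_le]), and
    the functional equation of Gamma turn this into A. When c = a or c = b,
    F is (1 - z)^(-d) itself and h vanishes.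

    The only property of Gamma that goes beyond the functional equation is
    Gamma(n + p) ~ n^p Gamma(n) ([Gamma_asymptotic_pos]), a consequence of
    logarithmic convexity ([Gamma_integral_add_le]). *)

(** * The Gamma integral *)

(** The integrals over compact intervals increase with the interval, so they
    converge to their supremum. *)
Lemma is_RInt_gen_nonneg_bounded (f : R -> R) (M : R) :
  (forall t, 0 < t -> continuous f t) ->
  (forall t, 0 < t -> 0 <= f t) ->
  (forall u v, 0 < u <= v -> RInt f u v <= M) ->
  exists l, is_RInt_gen f (at_right 0) (Rbar_locally p_infty) l /\
    (forall u v, 0 < u <= v -> RInt f u v <= l).
Proof.
intros Hc Hp HM.
assert (Hex : forall u v, 0 < u -> 0 < v -> ex_RInt f u v).
{ intros u v Hu Hv; apply (ex_RInt_continuous (V := R_CompleteNormedModule)).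
  intros z Hz; apply Hc. revert Hz; unfold Rmin; destruct Rle_dec; lra. }
destruct (completeness (fun r => exists u v, 0 < u <= v /\ r = RInt f u v))
  as [l [Hub Hlub]].
{ exists M; intros r (u & v & Huv & ->); now apply HM. }
{ exists (RInt f 1 1), 1, 1; split; [lra | reflexivity]. }
assert (Hle : forall u v, 0 < u <= v -> RInt f u v <= l).
{ intros u v Huv; apply Hub; now exists u, v. }
exists l; split; [| exact Hle].
intros P [eps HP].
assert (Hnear : exists u0 v0, 0 < u0 <= v0 /\ l - eps < RInt f u0 v0).
{ destruct (Classical_Prop.classic
    (exists u0 v0, 0 < u0 <= v0 /\ l - eps < RInt f u0 v0)) as [H | H]; [exact H |].
  exfalso. assert (l <= l - eps).
  { apply Hlub; intros r (u & v & Huv & ->).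
    apply Rnot_lt_le; intros Hlt; apply H; now exists u, v. }
  destruct eps as [e He]; simpl in *; lra. }
destruct Hnear as (u0 & v0 & H0 & Heps).
apply (Filter_prod _ _ _ (fun u => 0 < u < u0) (fun v => v0 < v)).
- exists (mkposreal u0 (proj1 H0)); intros y Hy Hy0.
  change (Rabs (y - 0) < u0) in Hy. apply Rabs_def2 in Hy; lra.
- now exists v0.
- intros u v Hu Hv; exists (RInt f u v); split; simpl.
  + apply (RInt_correct (V := R_CompleteNormedModule)), Hex; lra.
  + apply HP. change (Rabs (RInt f u v - l) < eps).
    assert (Hs : RInt f u v = RInt f u u0 + RInt f u0 v0 + RInt f v0 v).
    { rewrite <- (RInt_Chasles f u u0 v), <- (RInt_Chasles f u0 v0 v);
        try (apply Hex; lra). unfold plus; simpl; ring. }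
    assert (0 <= RInt f u u0) by (apply RInt_ge_0; [lra | apply Hex; lra | intros; apply Hp; lra]).
    assert (0 <= RInt f v0 v) by (apply RInt_ge_0; [lra | apply Hex; lra | intros; apply Hp; lra]).
    assert (RInt f u v <= l) by (apply Hle; lra).
    destruct eps as [e He]; simpl in *; apply Rabs_def1; lra.
Qed.

Definition Gamma_integrand (x t : R) : R := Rpower t (x - 1) * exp (- t).

Lemma Gamma_integrand_pos x t : 0 < Gamma_integrand x t.
Proof. apply Rmult_lt_0_compat; apply exp_pos. Qed.

Lemma Gamma_integrand_continuous x t : 0 < t -> continuous (Gamma_integrand x) t.
Proof.
intros Ht; apply (ex_derive_continuous (V := R_NormedModule)).
unfold Gamma_integrand, Rpower; auto_derive; exact Ht.
Qed.

(** The graph of the logarithm lies below its tangent at m. The choice of m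
    is free, and gives both the decay of the Gamma integrand and Young's
    inequality. *)
Lemma ln_le_tangent s m : 0 < s -> 0 < m -> ln s <= s / m - 1 + ln m.
Proof.
intros Hs Hm.
assert (Hsm : 0 < s / m) by (apply Rdiv_lt_0_compat; lra).
replace (ln s) with (ln (s / m) + ln m).
2:{ rewrite ln_div by lra; ring. }
generalize (exp_ineq1_le (ln (s / m))); rewrite exp_ln by lra; lra.
Qed.

Lemma exp_le_mono x y : x <= y -> exp x <= exp y.
Proof. intros [H | ->]; [apply Rlt_le, exp_increasing, H | apply Rle_refl]. Qed.

(** The exponential is traded for a power of 1 + t chosen so that
    t^(x - 1) times the right-hand side has an elementary, bounded primitive on
    the whole half-line, namely a multiple of (t / (1 + t))^x. *)
Lemma exp_decay x t : 0 < x -> 0 < t ->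
  exp (- t) <= Rpower (x + 1) (x + 1) * Rpower (1 + t) (- (x + 1)).
Proof.
intros Hx Ht; unfold Rpower; rewrite <- exp_plus; apply exp_le_mono.
assert (H := ln_le_tangent (1 + t) (x + 1) ltac:(lra) ltac:(lra)).
apply (Rmult_le_compat_l (x + 1)) in H; [| lra].
replace ((x + 1) * ((1 + t) / (x + 1) - 1 + ln (x + 1)))
  with ((1 + t) - (x + 1) + (x + 1) * ln (x + 1)) in H by (field; lra).
lra.
Qed.

Lemma is_RInt_gen_Gamma x : 0 < x ->
  exists l, is_RInt_gen (Gamma_integrand x) (at_right 0) (Rbar_locally p_infty) l /\
    (forall u v, 0 < u <= v -> RInt (Gamma_integrand x) u v <= l).
Proof.
intros Hx; set (K := Rpower (x + 1) (x + 1)).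
apply is_RInt_gen_nonneg_bounded with (M := K / x).
- apply Gamma_integrand_continuous.
- intros t _; apply Rlt_le, Gamma_integrand_pos.
- intros u v Huv.
  (* G is the bounded primitive of the majorant g. *)
  set (G t := K / x * exp (x * (ln t - ln (1 + t)))).
  set (g t := K * (Rpower t (x - 1) * Rpower (1 + t) (- (x + 1)))).
  assert (HK : 0 < K) by apply exp_pos.
  assert (HG : is_RInt g u v (G v - G u)).
  { apply (is_RInt_derive (V := R_CompleteNormedModule) G g);
      rewrite Rmin_left, Rmax_right by lra; intros t Ht.
    - unfold G; auto_derive; [lra |].
      unfold g, Rpower.
      replace ((x - 1) * ln t) with (x * ln t + - ln t) by ring.
      replace (- (x + 1) * ln (1 + t)) with (- (x * ln (1 + t)) + - ln (1 + t)) by ring.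
      replace (x * (ln t + - ln (1 + t))) with (x * ln t + - (x * ln (1 + t))) by ring.
      rewrite !exp_plus, (exp_Ropp (ln t)), (exp_Ropp (ln (1 + t))), !exp_ln by lra.
      field; lra.
    - apply (ex_derive_continuous (V := R_NormedModule)).
      unfold g, Rpower; auto_derive; lra. }
  apply Rle_trans with (RInt g u v).
  + apply RInt_le; [lra | | now exists (G v - G u) |].
    * apply (ex_RInt_continuous (V := R_CompleteNormedModule)).
      rewrite Rmin_left, Rmax_right by lra.
      intros t Ht; apply Gamma_integrand_continuous; lra.
    * intros t Ht; unfold g, Gamma_integrand.
      replace (K * (Rpower t (x - 1) * Rpower (1 + t) (- (x + 1))))
        with (Rpower t (x - 1) * (K * Rpower (1 + t) (- (x + 1)))) by ring.
      apply Rmult_le_compat_l; [apply Rlt_le, exp_pos | apply exp_decay; lra].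
  + rewrite (is_RInt_unique _ _ _ _ HG).
    assert (HKx : 0 < K / x) by (apply Rdiv_lt_0_compat; lra).
    assert (0 < G u) by (apply Rmult_lt_0_compat; [lra | apply exp_pos]).
    assert (G v <= K / x * 1); [| lra].
    apply Rmult_le_compat_l; [lra |].
    apply Rle_trans with (exp 0); [apply exp_le_mono | rewrite exp_0; lra].
    assert (ln v < ln (1 + v)) by (apply ln_increasing; lra).
    assert (x * ln v < x * ln (1 + v)) by (apply Rmult_lt_compat_l; lra).
    lra.
Qed.

Lemma Gamma_integral_unique x l :
  is_RInt_gen (Gamma_integrand x) (at_right 0) (Rbar_locally p_infty) l ->
  Gamma_integral x = l.
Proof. exact (is_RInt_gen_unique (V := R_CompleteNormedModule) _ l). Qed.

Lemma Gamma_integral_correct x : 0 < x ->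
  is_RInt_gen (Gamma_integrand x) (at_right 0) (Rbar_locally p_infty) (Gamma_integral x).
Proof.
intros Hx; destruct (is_RInt_gen_Gamma x Hx) as (l & Hl & _).
apply (RInt_gen_correct (V := R_CompleteNormedModule)); now exists l.
Qed.

Lemma Gamma_integral_pos x : 0 < x -> 0 < Gamma_integral x.
Proof.
intros Hx; destruct (is_RInt_gen_Gamma x Hx) as (l & Hl & Hle).
rewrite (Gamma_integral_unique x l Hl).
apply Rlt_le_trans with (RInt (Gamma_integrand x) 1 2); [| apply Hle; lra].
apply RInt_gt_0; [lra | intros; apply Gamma_integrand_pos |].
intros t Ht; apply Gamma_integrand_continuous; lra.
Qed.

Lemma Gamma_prod_filter :
  filter_prod (at_right 0) (Rbar_locally p_infty) (fun ab => 0 < fst ab /\ fst ab <= snd ab).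
Proof.
apply (Filter_prod _ _ _ (fun u => 0 < u < 1) (fun v => 1 < v)).
- exists (mkposreal 1 Rlt_0_1); intros y Hy Hy0.
  change (Rabs (y - 0) < 1) in Hy. apply Rabs_def2 in Hy; lra.
- now exists 1.
- simpl; intros; lra.
Qed.

(** Integration by parts: the integrand is the derivative of t^x e^(-t),
    which vanishes at both ends. *)
Lemma is_RInt_gen_Gamma_boundary x : 0 < x ->
  is_RInt_gen (fun t => x * Gamma_integrand x t - Gamma_integrand (x + 1) t)
    (at_right 0) (Rbar_locally p_infty) 0.
Proof.
intros Hx; set (H t := Rpower t x * exp (- t)).
assert (Hd : forall t, 0 < t ->
  is_derive H t (x * Gamma_integrand x t - Gamma_integrand (x + 1) t)).
{ intros t Ht; unfold H, Gamma_integrand, Rpower.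
  auto_derive; [lra |].
  replace ((x - 1) * ln t) with (x * ln t + - ln t) by ring.
  replace ((x + 1 - 1) * ln t) with (x * ln t) by ring.
  rewrite exp_plus, (exp_Ropp (ln t)), exp_ln by lra. field; lra. }
apply is_RInt_gen_ext with (Derive H).
{ eapply filter_imp; [| exact Gamma_prod_filter]; intros [u v]; simpl; intros [Hu Huv] t.
  rewrite Rmin_left by lra; intros Ht; apply is_derive_unique, Hd; lra. }
replace 0 with (0 - 0) at 2 by ring.
apply is_RInt_gen_Derive.
- eapply filter_imp; [| exact Gamma_prod_filter]; intros [u v]; simpl; intros [Hu Huv] t.
  rewrite Rmin_left by lra; intros Ht; eexists; apply Hd; lra.
- eapply filter_imp; [| exact Gamma_prod_filter]; intros [u v]; simpl; intros [Hu Huv] t.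
  rewrite Rmin_left by lra; intros Ht.
  apply continuous_ext_loc
    with (fun t => x * Gamma_integrand x t - Gamma_integrand (x + 1) t).
  + exists (mkposreal t ltac:(lra)); intros y Hy.
    change (Rabs (y - t) < t) in Hy. apply Rabs_def2 in Hy.
    symmetry; apply is_derive_unique, Hd; lra.
  + apply (continuous_minus (V := R_NormedModule));
      [apply (continuous_scal_r (V := R_NormedModule)) |];
      apply Gamma_integrand_continuous; lra.
- apply (filterlim_le_le (fun _ => 0) H (fun t => exp (x * ln t)) (Finite 0)).
  + exists (mkposreal 1 Rlt_0_1); intros t _ Ht; unfold H, Rpower; split.
    * apply Rlt_le, Rmult_lt_0_compat; apply exp_pos.
    * rewrite <- exp_plus; apply exp_le_mono; lra.
  + apply filterlim_const.
  + apply filterlim_comp with (Rbar_locally m_infty); [| exact is_lim_exp_m].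
    apply filterlim_comp with (Rbar_locally m_infty); [exact is_lim_ln_0 |].
    assert (L := filterlim_Rbar_mult_l x m_infty).
    unfold Rbar_mult, Rbar_mult' in L; simpl in L.
    destruct (Rle_dec 0 x) as [h |]; [| lra].
    destruct (Rle_lt_or_eq_dec 0 x h) as [_ |]; [exact L | lra].
- set (K := Rpower (x + 1) (x + 1)).
  apply (filterlim_le_le (fun _ => 0) H (fun t => K / t) (Finite 0)).
  + (* The bound that made the integral converge also gives H t <= K / t. *)
    exists 0; intros t Ht; unfold H; split.
    * apply Rlt_le, Rmult_lt_0_compat; apply exp_pos.
    * apply Rle_trans with (Rpower t x * (K * Rpower t (- (x + 1)))).
      { apply Rmult_le_compat_l; [apply Rlt_le, exp_pos |].
        eapply Rle_trans; [apply (exp_decay x t); lra |].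
        apply Rmult_le_compat_l; [apply Rlt_le, exp_pos |].
        rewrite !Rpower_Ropp; apply Rinv_le_contravar; [apply exp_pos |].
        apply Rle_Rpower_l; lra. }
      right; replace (- (x + 1)) with (- x + - (1)) by ring.
      rewrite Rpower_plus, !Rpower_Ropp, Rpower_1 by lra.
      field; split; [lra |]. apply Rgt_not_eq, exp_pos.
  + apply filterlim_const.
  + replace (Finite 0) with (Rbar_mult K (Rbar_inv p_infty)) by (simpl; f_equal; ring).
    apply (is_lim_scal_l Rinv K p_infty 0). apply is_lim_inv with (l := p_infty) (f := fun y => y);
     [apply is_lim_id | discriminate].
Qed.

Lemma Gamma_integral_succ x : 0 < x -> Gamma_integral (x + 1) = x * Gamma_integral x.
Proof.
intros Hx.
assert (H1 := is_RInt_gen_scal _ x _ (Gamma_integral_correct x Hx)).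
assert (H2 := is_RInt_gen_minus _ _ _ _ H1 (Gamma_integral_correct (x + 1) ltac:(lra))).
assert (H3 := is_RInt_gen_unique (V := R_CompleteNormedModule) _ _ H2).
assert (H4 := is_RInt_gen_unique (V := R_CompleteNormedModule) _ _
               (is_RInt_gen_Gamma_boundary x Hx)).
unfold scal, minus, plus, opp in H3; simpl in H3; unfold mult in H3; simpl in H3.
change (RInt_gen (fun t => x * Gamma_integrand x t - Gamma_integrand (x + 1) t)
 (at_right 0) (Rbar_locally p_infty) = x * Gamma_integral x + - Gamma_integral (x + 1)) in H3.
lra.
Qed.

(** Young's inequality: apply the tangent of the logarithm at the point
    m = 1 - th + th s to both 1 and s, and average with weights 1 - th and th. *)
Lemma Rpower_le_affine th s : 0 <= th <= 1 -> 0 < s ->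
  Rpower s th <= 1 - th + th * s.
Proof.
intros Hth Hs; set (m := 1 - th + th * s).
assert (Hm : 0 < m).
{ unfold m. destruct (Req_dec th 0) as [-> | Hn]; [lra |].
  assert (0 < th * s) by (apply Rmult_lt_0_compat; lra). lra. }
rewrite <- (exp_ln m Hm); apply exp_le_mono.
assert (H1 := ln_le_tangent 1 m Rlt_0_1 Hm); rewrite ln_1 in H1.
assert (H2 := ln_le_tangent s m Hs Hm).
apply (Rmult_le_compat_l (1 - th)) in H1; [| lra].
apply (Rmult_le_compat_l th) in H2; [| lra].
assert (H3 : (1 - th) * (1 / m - 1 + ln m) + th * (s / m - 1 + ln m) = ln m)
  by (unfold m in Hm |- *; field; lra).
lra.
Qed.

(** Logarithmic convexity of Gamma on [x, x + 1]. Write t^th = x^th (t / x)^th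
    in the integrand and bound the last factor by 1 - th + th t / x: since
    Gamma (x + 1) = x Gamma x, this bound integrates to Gamma x exactly. *)
Lemma Gamma_integral_add_le x th : 0 < x -> 0 <= th <= 1 ->
  Gamma_integral (x + th) <= Rpower x th * Gamma_integral x.
Proof.
intros Hx Hth.
assert (Hx1 : 0 < x + 1) by lra. assert (Hxt : 0 < x + th) by lra.
assert (H1 := is_RInt_gen_scal _ (Rpower x th * (1 - th)) _ (Gamma_integral_correct x Hx)).
assert (H2 := is_RInt_gen_scal _ (Rpower x th * (th / x)) _
                (Gamma_integral_correct (x + 1) Hx1)).
assert (H3 := is_RInt_gen_plus _ _ _ _ H1 H2).
eapply Rle_trans; [apply Rle_abs |].
apply Rle_trans with (plus (scal (Rpower x th * (1 - th)) (Gamma_integral x))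
                        (scal (Rpower x th * (th / x)) (Gamma_integral (x + 1)))).
- refine (RInt_gen_norm (V := R_CompleteNormedModule) _ _ _ _ _ _
    (Gamma_integral_correct (x + th) Hxt) H3).
  + eapply filter_imp; [| exact Gamma_prod_filter]; simpl; intros ab H; apply H.
  + eapply filter_imp; [| exact Gamma_prod_filter]; intros [u v]; simpl.
    intros [Hu Huv] t Ht.
    change (Rabs (Gamma_integrand (x + th) t) <=
      Rpower x th * (1 - th) * Gamma_integrand x t
        + Rpower x th * (th / x) * Gamma_integrand (x + 1) t).
    rewrite Rabs_right by apply Rle_ge, Rlt_le, Gamma_integrand_pos.
    assert (Hts : 0 < t / x) by (apply Rdiv_lt_0_compat; lra).
    unfold Gamma_integrand.
    replace (Rpower t (x + th - 1)) with (Rpower x th * Rpower (t / x) th * Rpower t (x - 1)).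
    2:{ rewrite Rpower_mult_distr by lra.
        replace (x * (t / x)) with t by (field; lra).
        rewrite <- Rpower_plus; f_equal; ring. }
    replace (Rpower t (x + 1 - 1)) with (t * Rpower t (x - 1)).
    2:{ rewrite <- (Rpower_1 t) at 1 by lra; rewrite <- Rpower_plus; f_equal; ring. }
    replace (Rpower x th * (1 - th) * (Rpower t (x - 1) * exp (- t)) +
             Rpower x th * (th / x) * (t * Rpower t (x - 1) * exp (- t)))
      with (Rpower x th * (1 - th + th * (t / x)) * Rpower t (x - 1) * exp (- t))
      by (field; lra).
    repeat apply Rmult_le_compat_r; try (apply Rlt_le, exp_pos).
    apply Rmult_le_compat_l; [apply Rlt_le, exp_pos |].
    now apply Rpower_le_affine.
- right; unfold plus, scal; simpl; unfold mult; simpl.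
  rewrite Gamma_integral_succ by lra; field; lra.
Qed.

Lemma Gamma_integral_add_nat p n : 0 < p ->
  Gamma_integral (p + INR n) = pochhammer p n * Gamma_integral p.
Proof.
intros Hp; induction n as [| n IH].
- simpl; rewrite Rplus_0_r; ring.
- rewrite S_INR, <- Rplus_assoc, Gamma_integral_succ, IH; [simpl; ring |].
  assert (h := pos_INR n); lra.
Qed.

(** Gamma (n + p) is asymptotic to n^p Gamma n. This is what turns
    quotients of Pochhammer symbols into quotients of Gamma values. *)
Definition Gamma_asymptotic (p : R) : Prop :=
  is_lim_seq (fun n => Gamma_integral (INR n + p)
                         / (Gamma_integral (INR n) * Rpower (INR n) p)) 1.

Lemma is_lim_seq_shifted_ratio q : is_lim_seq (fun n => 1 + q / INR n) 1.
Proof.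
replace (Finite 1) with (Rbar_plus (Finite 1) (Rbar_mult q (Rbar_inv p_infty)))
  by (simpl; f_equal; ring).
apply is_lim_seq_plus'; [apply is_lim_seq_const |].
apply (is_lim_seq_scal_l (fun n => / INR n) q 0).
apply (is_lim_seq_inv INR p_infty); [apply is_lim_seq_INR | discriminate].
Qed.

(** Logarithmic convexity on [n, n + 1] gives the upper bound 1; on
    [n + th, n + th + 1], together with Gamma (n + 1) = n Gamma n, it gives the
    lower bound n / (n + th). *)
Lemma Gamma_asymptotic_unit th : 0 <= th <= 1 -> Gamma_asymptotic th.
Proof.
intros Hth.
apply is_lim_seq_le_le_loc with (u := fun n => / (1 + th / INR n)) (w := fun _ => 1).
- exists 1%nat; intros n Hn; apply le_INR in Hn; simpl in Hn.
  assert (HG : 0 < Gamma_integral (INR n)) by (apply Gamma_integral_pos; lra).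
  assert (HR : 0 < Rpower (INR n) th) by apply exp_pos.
  assert (HGR : 0 < Gamma_integral (INR n) * Rpower (INR n) th)
    by (apply Rmult_lt_0_compat; lra).
  split.
  + assert (H := Gamma_integral_add_le (INR n + th) (1 - th) ltac:(lra) ltac:(lra)).
    replace (INR n + th + (1 - th)) with (INR n + 1) in H by ring.
    rewrite Gamma_integral_succ in H by lra.
    assert (HP : Rpower (INR n + th) (1 - th) * Rpower (INR n) th <= INR n + th).
    { rewrite <- (Rpower_1 (INR n + th)) at 2 by lra.
      replace 1 with (1 - th + th) at 2 by ring; rewrite Rpower_plus.
      apply Rmult_le_compat_l; [apply Rlt_le, exp_pos | apply Rle_Rpower_l; lra]. }
    apply (Rmult_le_reg_r (Gamma_integral (INR n) * Rpower (INR n) th)); [lra |].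
    unfold Rdiv at 2; rewrite Rmult_assoc, Rinv_l, Rmult_1_r by lra.
    apply (Rmult_le_reg_l (INR n + th)); [lra |].
    replace ((INR n + th) * (/ (1 + th / INR n)
              * (Gamma_integral (INR n) * Rpower (INR n) th)))
      with (INR n * Gamma_integral (INR n) * Rpower (INR n) th)
      by (field; repeat split; try lra).
    apply Rle_trans with
      (Rpower (INR n + th) (1 - th) * Gamma_integral (INR n + th) * Rpower (INR n) th).
    { apply Rmult_le_compat_r; lra. }
    replace (Rpower (INR n + th) (1 - th) * Gamma_integral (INR n + th) * Rpower (INR n) th)
      with (Rpower (INR n + th) (1 - th) * Rpower (INR n) th * Gamma_integral (INR n + th))
      by ring.
    apply Rmult_le_compat_r; [| exact HP].
    apply Rlt_le, Gamma_integral_pos; lra.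
  + apply (Rmult_le_reg_r (Gamma_integral (INR n) * Rpower (INR n) th)); [lra |].
    unfold Rdiv; rewrite Rmult_assoc, Rinv_l, Rmult_1_r by lra.
    rewrite Rmult_1_l, (Rmult_comm (Gamma_integral _)).
    apply Gamma_integral_add_le; lra.
- replace (Finite 1) with (Rbar_inv 1) by (simpl; f_equal; field).
  apply is_lim_seq_inv; [apply is_lim_seq_shifted_ratio |].
  intros H; injection H; lra.
- apply is_lim_seq_const.
Qed.

Lemma Gamma_asymptotic_succ p : 0 <= p -> Gamma_asymptotic p -> Gamma_asymptotic (p + 1).
Proof.
intros Hp H.
assert (L := is_lim_seq_mult' _ _ _ _ H (is_lim_seq_shifted_ratio p)).
rewrite Rmult_1_l in L; apply is_lim_seq_ext_loc with (2 := L).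
exists 1%nat; intros n Hn; apply le_INR in Hn; simpl in Hn.
replace (INR n + (p + 1)) with (INR n + p + 1) by ring.
rewrite Gamma_integral_succ, Rpower_plus, Rpower_1 by lra.
assert (0 < Gamma_integral (INR n)) by (apply Gamma_integral_pos; lra).
assert (0 < Rpower (INR n) p) by apply exp_pos.
field; lra.
Qed.

Lemma Gamma_asymptotic_pos p : 0 < p -> Gamma_asymptotic p.
Proof.
intros Hp; destruct (nfloor_ex p (Rlt_le _ _ Hp)) as [k Hk].
revert p Hp Hk; induction k as [| k IH]; intros p Hp Hk.
- apply Gamma_asymptotic_unit; simpl in Hk; lra.
- rewrite S_INR in Hk. destruct (Req_dec p 1) as [-> | Hn].
  { apply Gamma_asymptotic_unit; lra. }
  assert (h := pos_INR k).
  replace p with (p - 1 + 1) by ring; apply Gamma_asymptotic_succ; [lra |].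
  apply IH; lra.
Qed.

Lemma pochhammer_pos p n : 0 < p -> 0 < pochhammer p n.
Proof.
intros Hp; induction n as [| n IH]; simpl; [lra |].
apply Rmult_lt_0_compat; [exact IH |]. assert (h := pos_INR n); lra.
Qed.

(** By (p)_n = Gamma (p + n) / Gamma p, the powers of n in the asymptotics
    cancel exactly when p + q = r + s. *)
Lemma pochhammer_ratio_lim p q r s :
  0 < p -> 0 < q -> 0 < r -> 0 < s -> p + q = r + s ->
  is_lim_seq (fun n => pochhammer p n * pochhammer q n / (pochhammer r n * pochhammer s n))
    (Gamma_integral r * Gamma_integral s / (Gamma_integral p * Gamma_integral q)).
Proof.
intros Hp Hq Hr Hs Heq.
assert (Gp := Gamma_integral_pos p Hp). assert (Gq := Gamma_integral_pos q Hq).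
assert (Gr := Gamma_integral_pos r Hr). assert (Gs := Gamma_integral_pos s Hs).
assert (Lp := Gamma_asymptotic_pos p Hp). assert (Lq := Gamma_asymptotic_pos q Hq).
assert (Lr := Gamma_asymptotic_pos r Hr). assert (Ls := Gamma_asymptotic_pos s Hs).
assert (L1 := is_lim_seq_mult' _ _ _ _ Lp Lq).
assert (L2 := is_lim_seq_mult' _ _ _ _ Lr Ls).
assert (L3 := is_lim_seq_div' _ _ _ _ L1 L2 ltac:(lra)).
assert (L4 := is_lim_seq_mult' _ _ _ _ (is_lim_seq_const
  (Gamma_integral r * Gamma_integral s / (Gamma_integral p * Gamma_integral q))) L3).
replace (Gamma_integral r * Gamma_integral s / (Gamma_integral p * Gamma_integral q))
  with (Gamma_integral r * Gamma_integral s / (Gamma_integral p * Gamma_integral q)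
         * (1 * 1 / (1 * 1))) by (field; lra).
apply is_lim_seq_ext_loc with (2 := L4).
exists 1%nat; intros n Hn; apply le_INR in Hn; simpl in Hn.
rewrite !(Rplus_comm (INR n)), !Gamma_integral_add_nat by assumption.
assert (HG : 0 < Gamma_integral (INR n)) by (apply Gamma_integral_pos; lra).
assert (HR : Rpower (INR n) p * Rpower (INR n) q = Rpower (INR n) r * Rpower (INR n) s)
  by (rewrite <- !Rpower_plus, Heq; reflexivity).
assert (0 < Rpower (INR n) p) by apply exp_pos.
assert (0 < Rpower (INR n) q) by apply exp_pos.
assert (0 < Rpower (INR n) r) by apply exp_pos.
assert (0 < Rpower (INR n) s) by apply exp_pos.
assert (pr := pochhammer_pos r n Hr). assert (ps := pochhammer_pos s n Hs).
replace (Rpower (INR n) q) with (Rpower (INR n) r * Rpower (INR n) s / Rpower (INR n) p)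
  by (rewrite <- HR; field; lra).
field; repeat split; lra.
Qed.

Lemma Gamma_eq_integral x : 0 < x -> Gamma x = Gamma_integral x.
Proof.
intros Hx; unfold Gamma, Gamma_shift.
replace (Z.to_nat (up (- x))) with 0%nat.
- simpl; rewrite Rplus_0_r; field.
- destruct (archimed (- x)) as [_ H].
  assert (up (- x) < 1)%Z by (apply lt_IZR; lra). lia.
Qed.

(** On (-1, 0) the continuation uses a single unit step. *)
Lemma Gamma_eq_integral_succ x : -1 < x -> x <> 0 -> Gamma x = Gamma_integral (x + 1) / x.
Proof.
intros Hx Hx0; destruct (Rlt_le_dec 0 x) as [H | H].
{ rewrite Gamma_eq_integral, Gamma_integral_succ by exact H; field; lra. }
unfold Gamma, Gamma_shift.
replace (up (- x)) with 1%Z.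
- simpl; f_equal; ring.
- apply tech_up; lra.
Qed.

(** * Summing the coefficients *)

Definition hyp_coef (a b c : R) (n : nat) : R :=
  pochhammer a n * pochhammer b n / (pochhammer c n * INR (fact n)).

(** The Taylor coefficients of (1 - z)^(-d). *)
Definition binom_coef (d : R) (n : nat) : R := pochhammer d n / INR (fact n).

Lemma hyp_coef_pos a b c n : 0 < a -> 0 < b -> 0 < c -> 0 < hyp_coef a b c n.
Proof.
intros Ha Hb Hc; apply Rdiv_lt_0_compat; apply Rmult_lt_0_compat;
  try (now apply pochhammer_pos). apply INR_fact_lt_0.
Qed.

Lemma binom_coef_pos d n : 0 < d -> 0 < binom_coef d n.
Proof.
intros Hd; apply Rdiv_lt_0_compat; [now apply pochhammer_pos | apply INR_fact_lt_0].
Qed.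

Lemma hyp_coef_succ a b c n : 0 < c ->
  hyp_coef a b c (S n)
    = hyp_coef a b c n * ((a + INR n) * (b + INR n)) / ((c + INR n) * INR (S n)).
Proof.
intros Hc; unfold hyp_coef.
replace (INR (fact (S n))) with (INR (S n) * INR (fact n)) by now rewrite <- mult_INR.
simpl pochhammer.
assert (h := pos_INR n). assert (hf := INR_fact_lt_0 n). assert (hp := pochhammer_pos c n Hc).
assert (hS : INR (S n) = INR n + 1) by apply S_INR.
field; repeat split; lra.
Qed.

Lemma binom_coef_succ d n : binom_coef d (S n) = binom_coef d n * (d + INR n) / INR (S n).
Proof.
unfold binom_coef.
replace (INR (fact (S n))) with (INR (S n) * INR (fact n)) by now rewrite <- mult_INR.
simpl pochhammer.
assert (h := pos_INR n). assert (hf := INR_fact_lt_0 n).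
assert (hS : INR (S n) = INR n + 1) by apply S_INR.
field; split; lra.
Qed.

Lemma pochhammer_shift c n : pochhammer (c + 1) n * c = pochhammer c n * (c + INR n).
Proof.
induction n as [| n IH]; [simpl; ring |].
rewrite S_INR; simpl pochhammer.
transitivity (pochhammer (c + 1) n * c * (c + 1 + INR n)); [ring | rewrite IH; ring].
Qed.

Lemma hyp_coef_shift a b c n : 0 < c ->
  hyp_coef a b (c + 1) n = hyp_coef a b c n * c / (c + INR n).
Proof.
intros Hc; unfold hyp_coef.
assert (h := pos_INR n). assert (hf := INR_fact_lt_0 n). assert (hp := pochhammer_pos c n Hc).
replace (pochhammer (c + 1) n) with (pochhammer c n * (c + INR n) / c)
  by (rewrite <- pochhammer_shift; field; lra).
field; repeat split; lra.
Qed.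

(** The contiguous relation between F(a, b; c; 1) and F(a, b; c + 1; 1), for
    partial sums. With u_n = hyp_coef a b c n, the combination of the n-th terms
    equals n u_n - (n + 1) u_(n + 1), so it telescopes. It holds for either sign
    of c - a - b, and serves with both. *)
Lemma hyp_coef_contiguous_sum a b c N : 0 < c ->
  (c - a - b) * sum_f_R0 (hyp_coef a b c) N
    = (c - a) * (c - b) / c * sum_f_R0 (hyp_coef a b (c + 1)) N
        - INR (S N) * hyp_coef a b c (S N).
Proof.
intros Hc; induction N as [| N IH].
- simpl sum_f_R0; rewrite hyp_coef_succ, hyp_coef_shift by exact Hc.
  simpl INR. unfold hyp_coef; simpl; field; lra.
- rewrite !tech5, Rmult_plus_distr_l, IH, (hyp_coef_succ a b c (S N)),
    (hyp_coef_shift a b c (S N)) by exact Hc.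
  assert (h := pos_INR (S N)). rewrite (S_INR (S N)). field; lra.
Qed.

Lemma binom_coef_sum d N : d <> 0 ->
  sum_f_R0 (binom_coef d) N = INR (S N) * binom_coef d (S N) / d.
Proof.
intros Hd; induction N as [| N IH].
- simpl; unfold binom_coef; simpl; field; lra.
- rewrite tech5, IH, (binom_coef_succ d (S N)), (S_INR (S N)).
  assert (h := pos_INR (S N)). field; lra.
Qed.

(** Since (c + m)_(n + 1) >= (c + m) (c)_n, the coefficient is O(1 / m). *)
Lemma hyp_coef_shift_lim a b c n : 0 < a -> 0 < b -> 0 < c ->
  is_lim_seq (fun m => hyp_coef a b (c + INR m) (S n)) 0.
Proof.
intros Ha Hb Hc.
assert (Hp : forall m, (c + INR m) * pochhammer c n <= pochhammer (c + INR m) (S n)).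
{ intros m; assert (hm := pos_INR m); clear - Hc hm; induction n as [| n IH]; [simpl; lra |].
  change (pochhammer (c + INR m) (S (S n)))
    with (pochhammer (c + INR m) (S n) * (c + INR m + INR (S n))).
  simpl (pochhammer c (S n)); rewrite <- Rmult_assoc, S_INR.
  assert (hn := pos_INR n). assert (hp := pochhammer_pos c n Hc).
  apply Rmult_le_compat; try lra.
  apply Rmult_le_pos; lra. }
set (K := pochhammer a (S n) * pochhammer b (S n) / (pochhammer c n * INR (fact (S n)))).
apply is_lim_seq_le_le with (u := fun _ => 0) (w := fun m => K * / (c + INR m)).
- intros m; assert (hm := pos_INR m); split.
  { apply Rlt_le, hyp_coef_pos; lra. }
  assert (hp := pochhammer_pos c n Hc). assert (hf := INR_fact_lt_0 (S n)).
  assert (hp2 := pochhammer_pos (c + INR m) (S n) ltac:(lra)).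
  assert (ha := pochhammer_pos a (S n) Ha). assert (hb := pochhammer_pos b (S n) Hb).
  unfold hyp_coef, K.
  replace (pochhammer a (S n) * pochhammer b (S n) / (pochhammer c n * INR (fact (S n)))
             * / (c + INR m))
    with (pochhammer a (S n) * pochhammer b (S n)
            / ((c + INR m) * pochhammer c n * INR (fact (S n)))) by (field; lra).
  apply Rmult_le_compat_l; [apply Rmult_le_pos; lra |].
  apply Rinv_le_contravar.
  + repeat apply Rmult_lt_0_compat; lra.
  + apply Rmult_le_compat_r; [lra | apply Hp].
- apply is_lim_seq_const.
- replace (Finite 0) with (Rbar_mult K (Rbar_inv p_infty)) by (simpl; f_equal; ring).
  apply is_lim_seq_scal_l, is_lim_seq_inv; [| discriminate].
  apply is_lim_seq_plus with c p_infty;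
    [apply is_lim_seq_const | apply is_lim_seq_INR | reflexivity].
Qed.

Lemma hyp_coef_shift_sum_lim a b c N : 0 < a -> 0 < b -> 0 < c ->
  is_lim_seq (fun m => sum_f_R0 (hyp_coef a b (c + INR m)) N) 1.
Proof.
intros Ha Hb Hc; induction N as [| N IH].
- apply is_lim_seq_ext with (fun _ => 1); [| apply is_lim_seq_const].
  intros m; unfold hyp_coef; simpl; field.
- assert (L := is_lim_seq_plus' _ _ _ _ IH (hyp_coef_shift_lim a b c N Ha Hb Hc)).
  rewrite Rplus_0_r in L; exact L.
Qed.

(** The upper bound in Gauss's summation theorem. When c - a - b > 0 the last
    term of the contiguous relation is negative, so raising c by 1 costs at most
    the factor (c - a) (c - b) / (c (c - a - b)). Raising c by m costs a quotient
    of Pochhammer symbols that converges to the Gamma quotient, while the partial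
    sum for c + m tends to its first term 1. *)
Lemma Gauss_sum_le a b c N : 0 < a -> 0 < b -> 0 < c - a - b ->
  sum_f_R0 (hyp_coef a b c) N
    <= Gamma_integral c * Gamma_integral (c - a - b)
         / (Gamma_integral (c - a) * Gamma_integral (c - b)).
Proof.
intros Ha Hb Hs; assert (Hc : 0 < c) by lra.
set (P m := pochhammer (c - a) m * pochhammer (c - b) m
              / (pochhammer c m * pochhammer (c - a - b) m)).
assert (HP : forall m, 0 < P m).
{ intros m; apply Rdiv_lt_0_compat; apply Rmult_lt_0_compat; apply pochhammer_pos; lra. }
assert (Hit : forall m,
  sum_f_R0 (hyp_coef a b c) N <= P m * sum_f_R0 (hyp_coef a b (c + INR m)) N).
{ induction m as [| m IH].
  - unfold P; simpl; rewrite Rplus_0_r; right; field.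
  - eapply Rle_trans; [exact IH |].
    assert (hm := pos_INR m).
    assert (H := hyp_coef_contiguous_sum a b (c + INR m) N ltac:(lra)).
    assert (Hu : 0 <= INR (S N) * hyp_coef a b (c + INR m) (S N)).
    { apply Rmult_le_pos; [apply pos_INR | apply Rlt_le, hyp_coef_pos; lra]. }
    assert (pc := pochhammer_pos c m Hc).
    assert (ps := pochhammer_pos (c - a - b) m Hs).
    replace (P (S m)) with (P m * (((c + INR m - a) * (c + INR m - b) / (c + INR m))
                              / (c + INR m - a - b))).
    2:{ unfold P; simpl; field; repeat split; lra. }
    rewrite Rmult_assoc; apply Rmult_le_compat_l; [apply Rlt_le, HP |].
    apply (Rmult_le_reg_l (c + INR m - a - b)); [lra |].
    rewrite S_INR, <- Rplus_assoc, H.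
    match goal with |- ?A * ?S1 - ?B <= ?d * (?A / ?d * ?S1) =>
      replace (d * (A / d * S1)) with (A * S1) by (field; lra) end.
    lra. }
assert (L := is_lim_seq_mult' _ _ _ _
  (pochhammer_ratio_lim (c - a) (c - b) c (c - a - b) ltac:(lra) ltac:(lra) Hc Hs ltac:(lra))
  (hyp_coef_shift_sum_lim a b c N Ha Hb Hc)).
rewrite Rmult_1_r in L.
exact (is_lim_seq_le _ _ _ _ Hit (is_lim_seq_const _) L).
Qed.

(** The quotient of [hyp_coef] by [binom_coef]: the factorials cancel. *)
Definition coef_ratio (a b c d : R) (n : nat) : R :=
  pochhammer a n * pochhammer b n / (pochhammer c n * pochhammer d n).

Lemma coef_ratio_pos a b c d n : 0 < a -> 0 < b -> 0 < c -> 0 < d -> 0 < coef_ratio a b c d n.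
Proof.
intros Ha Hb Hc Hd; apply Rdiv_lt_0_compat; apply Rmult_lt_0_compat; now apply pochhammer_pos.
Qed.

Lemma hyp_coef_eq_ratio a b c d n : 0 < c -> 0 < d ->
  hyp_coef a b c n = binom_coef d n * coef_ratio a b c d n.
Proof.
intros Hc Hd; unfold hyp_coef, binom_coef, coef_ratio.
assert (hc := pochhammer_pos c n Hc). assert (hd := pochhammer_pos d n Hd).
assert (hf := INR_fact_lt_0 n). field; repeat split; lra.
Qed.

(** As (a + n) + (b + n) = (c + n) + (d + n), the two products
    (a + n) (b + n) and (c + n) (d + n) differ by the constant (a - d) (b - d).
    Hence the ratios form a monotone sequence. *)
Lemma coef_ratio_step a b c d n : 0 < c -> 0 < d -> d = a + b - c ->
  coef_ratio a b c d (S n) - coef_ratio a b c d n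
    = (a - d) * (b - d) * (coef_ratio a b c d n / ((c + INR n) * (d + INR n))).
Proof.
intros Hc Hd Heq; unfold coef_ratio; simpl.
assert (hc := pochhammer_pos c n Hc). assert (hd := pochhammer_pos d n Hd).
assert (hn := pos_INR n). replace a with (c + d - b) by lra.
field; repeat split; lra.
Qed.

Lemma sum_f_R0_le_widen (f : nat -> R) N M :
  (N <= M)%nat -> (forall n, (n <= M)%nat -> 0 <= f n) -> sum_f_R0 f N <= sum_f_R0 f M.
Proof.
induction 1 as [| M HM IH]; intros Hf; [lra |]; rewrite tech5.
assert (0 <= f (S M)) by (apply Hf; lia).
assert (sum_f_R0 f N <= sum_f_R0 f M) by (apply IH; intros; apply Hf; lia). lra.
Qed.

(** Let u_n, v_n be the coefficients of F and of (1 - z)^(-d), and t_n = u_n / v_n.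
    As t is monotone with limit B, all u_n - B v_n = v_n (t_n - B) have the same
    sign. Replacing B by t_(M + 1), the sum over n <= M of v_n (t_(M + 1) - t_n)
    is a multiple of a partial sum of F(a, b; c + 1; 1), because the partial sums
    of v are (M + 1) v_(M + 1) / d and the boundary term of the contiguous
    relation is the same (M + 1) u_(M + 1). Then M tends to infinity. *)
Lemma hyp_coef_remainder_sum a b c d (B G : R) :
  0 < a -> 0 < b -> 0 < c -> 0 < d -> d = a + b - c ->
  is_lim_seq (coef_ratio a b c d) B ->
  (forall N, sum_f_R0 (hyp_coef a b (c + 1)) N <= G) ->
  forall N, sum_f_R0 (fun n => Rabs (hyp_coef a b c n - B * binom_coef d n)) N
    <= Rabs ((a - d) * (b - d) / (c * d)) * G.
Proof.
intros Ha Hb Hc Hd Heq HB HG N.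
set (t := coef_ratio a b c d).
(* sg is the direction in which t moves. *)
assert (Hsg : exists sg, (sg = 1 \/ sg = -1) /\ 0 <= sg * ((a - d) * (b - d))).
{ destruct (Rle_lt_dec 0 ((a - d) * (b - d))); [exists 1 | exists (-1)]; split; auto; lra. }
destruct Hsg as (sg & Hsg1 & Hsg).
assert (Hstep : forall n, 0 <= sg * (t (S n) - t n)).
{ intros n; unfold t; rewrite coef_ratio_step, <- Rmult_assoc by assumption.
  apply Rmult_le_pos; [lra |]. assert (hn := pos_INR n).
  apply Rlt_le, Rdiv_lt_0_compat; [now apply coef_ratio_pos | apply Rmult_lt_0_compat; lra]. }
assert (Hmono : forall n m, (n <= m)%nat -> 0 <= sg * (t m - t n)).
{ induction 1 as [| m _ IH]; [lra |]. specialize (Hstep m). lra. }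
assert (Hlim : forall n, 0 <= sg * (B - t n)).
{ intros n. apply (is_lim_seq_le_loc (fun _ => 0) (fun m => sg * (t m - t n)) 0 (sg * (B - t n))).
  - now exists n; intros m Hm; apply Hmono.
  - apply is_lim_seq_const.
  - apply (is_lim_seq_scal_l (fun m => t m - t n) sg (B - t n)).
    apply is_lim_seq_minus'; [exact HB | apply is_lim_seq_const]. }
assert (Hv : forall n, 0 < binom_coef d n) by (intros; now apply binom_coef_pos).
assert (Hlin : forall T M, sum_f_R0 (fun n => binom_coef d n * (sg * (T - t n))) M
  = sg * (T * sum_f_R0 (binom_coef d) M - sum_f_R0 (hyp_coef a b c) M)).
{ intros T M; induction M as [| M IH]; [| rewrite !tech5, IH]; simpl sum_f_R0;
    rewrite (hyp_coef_eq_ratio a b c d) by assumption; fold t; ring. }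
assert (Hbound : forall M, (N <= M)%nat ->
  sum_f_R0 (fun n => binom_coef d n * (sg * (t (S M) - t n))) N
    <= Rabs ((a - d) * (b - d) / (c * d)) * G).
{ intros M HM.
  apply Rle_trans with (sum_f_R0 (fun n => binom_coef d n * (sg * (t (S M) - t n))) M).
  { apply sum_f_R0_le_widen; [exact HM |]; intros n Hn.
    apply Rmult_le_pos; [apply Rlt_le, Hv | apply Hmono; lia]. }
  rewrite Hlin, binom_coef_sum by lra.
  assert (H := hyp_coef_contiguous_sum a b c M Hc).
  rewrite (hyp_coef_eq_ratio a b c d (S M)) in H by assumption; fold t in H.
  replace (Rabs ((a - d) * (b - d) / (c * d))) with (sg * ((a - d) * (b - d)) / (c * d)).
  2:{ assert (Hcd : 0 < c * d) by (now apply Rmult_lt_0_compat).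
      rewrite <- (Rabs_right (sg * ((a - d) * (b - d)) / (c * d))).
      - unfold Rdiv; rewrite !Rabs_mult.
        replace (Rabs sg) with 1 by
          (destruct Hsg1 as [-> | ->]; unfold Rabs; destruct Rcase_abs; lra).
        ring.
      - apply Rle_ge, Rmult_le_pos; [exact Hsg | apply Rlt_le, Rinv_0_lt_compat, Hcd]. }
  apply Rle_trans with (sg * ((a - d) * (b - d)) / (c * d) * sum_f_R0 (hyp_coef a b (c + 1)) M).
  - right. apply (Rmult_eq_reg_l d); [| lra].
    replace (d * (sg * (t (S M) * (INR (S M) * binom_coef d (S M) / d)
                          - sum_f_R0 (hyp_coef a b c) M)))
      with (sg * (INR (S M) * (binom_coef d (S M) * t (S M))
                   + (c - a - b) * sum_f_R0 (hyp_coef a b c) M))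
      by (rewrite Heq; field; lra).
    rewrite H; replace (c - a) with (b - d) by lra; replace (c - b) with (a - d) by lra.
    field; lra.
  - apply Rmult_le_compat_l; [| apply HG].
    apply Rmult_le_pos; [exact Hsg |].
    apply Rlt_le, Rinv_0_lt_compat; now apply Rmult_lt_0_compat. }
rewrite (sum_eq _ (fun n => binom_coef d n * (sg * (B - t n)))).
- rewrite Hlin.
  refine (is_lim_seq_le_loc (fun M => sum_f_R0 (fun n => binom_coef d n * (sg * (t (S M) - t n))) N)
    (fun _ => Rabs ((a - d) * (b - d) / (c * d)) * G)
    (Finite _) (Finite _) _ _ (is_lim_seq_const _)).
  { now exists N. }
  apply is_lim_seq_ext with (fun M =>
    sg * (t (S M) * sum_f_R0 (binom_coef d) N - sum_f_R0 (hyp_coef a b c) N)).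
  { intros M; symmetry; apply Hlin. }
  apply (is_lim_seq_scal_l _ sg (B * sum_f_R0 (binom_coef d) N - sum_f_R0 (hyp_coef a b c) N)).
  apply is_lim_seq_minus'; [| apply is_lim_seq_const].
  apply (is_lim_seq_scal_r _ _ B). now apply is_lim_seq_incr_1 in HB.
- intros n _; rewrite (hyp_coef_eq_ratio a b c d) by assumption; fold (t n).
  specialize (Hlim n); specialize (Hv n).
  destruct Hsg1 as [-> | ->].
  + rewrite Rabs_left1; [ring |].
    replace (binom_coef d n * t n - B * binom_coef d n)
      with (- (binom_coef d n * (1 * (B - t n)))) by ring.
    assert (0 <= binom_coef d n * (1 * (B - t n))) by (apply Rmult_le_pos; lra). lra.
  + replace (binom_coef d n * t n - B * binom_coef d n)
      with (binom_coef d n * (-1 * (B - t n))) by ring.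
    rewrite Rabs_right; [ring |]. apply Rle_ge, Rmult_le_pos; lra.
Qed.

(** * The binomial series as a complex power *)

Lemma is_series_C (a : nat -> C) (l : C) :
  is_series (fun n => Re (a n)) (Re l) -> is_series (fun n => Im (a n)) (Im l) ->
  is_series (V := C_NormedModule) a l.
Proof.
intros Hr Hi.
assert (Hsum : forall N, (sum_n (fun n => Re (a n)) N, sum_n (fun n => Im (a n)) N)
                          = sum_n (G := C_NormedModule) a N).
{ induction N as [| N IH]; [rewrite !sum_O; now destruct (a 0%nat) |].
  rewrite !sum_Sn, <- IH; reflexivity. }
unfold is_series.
apply (filterlim_ext _ _ Hsum).
apply filterlim_filter_le_2 with (2 := filterlim_pair _ _ Hr Hi).
intros P [eps HP].
apply (Filter_prod _ _ _ (ball (Re l) eps) (ball (Im l) eps));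
  [now exists eps | now exists eps |].
intros x y Hx Hy; apply HP; now split.
Qed.

Lemma binom_coef_le_1 d n : 0 < d < 1 -> binom_coef d n <= 1.
Proof.
intros Hd; induction n as [| n IH]; [unfold binom_coef; simpl; lra |].
rewrite binom_coef_succ, S_INR.
assert (h := pos_INR n). assert (hv := binom_coef_pos d n (proj1 Hd)).
apply (Rmult_le_reg_r (INR n + 1)); [lra |].
unfold Rdiv; rewrite Rmult_assoc, Rinv_l, Rmult_1_r, Rmult_1_l by lra.
apply Rle_trans with (1 * (d + INR n)); [apply Rmult_le_compat_r; lra | lra].
Qed.

(** The radius of convergence along the ray through z exceeds 1, since the
    terms stay bounded at r = 2 / (1 + |z|) > 1. *)
Lemma CV_radius_unit_disk (v f : nat -> R) (z : C) (t : R) :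
  Cmod z < 1 -> Rabs t <= 1 ->
  (forall n, 0 <= v n <= 1) -> (forall n, Rabs (f n) <= Cmod (z ^ n)) ->
  Rbar_lt (Rabs t) (CV_radius (fun n => v n * f n)).
Proof.
intros Hz Ht Hv Hf; assert (Hz0 := Cmod_ge_0 z).
set (r := 2 / (1 + Cmod z)).
assert (Hr : 1 < r).
{ apply (Rmult_lt_reg_r (1 + Cmod z)); [lra |].
  unfold r, Rdiv; rewrite Rmult_assoc, Rinv_l; lra. }
apply Rbar_lt_le_trans with r; [simpl; lra |].
apply (proj1 (CV_radius_bounded _)); exists 1; intros n.
rewrite !Rabs_mult, (Rabs_right (v n)) by (apply Rle_ge, Hv).
rewrite (Rabs_right (r ^ n)) by (apply Rle_ge, pow_le; lra).
apply Rle_trans with (1 * Cmod z ^ n * r ^ n).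
- apply Rmult_le_compat_r; [apply pow_le; lra |].
  rewrite <- Cmod_pow; apply Rmult_le_compat;
    [apply Hv | apply Rabs_pos | apply Hv | apply Hf].
- rewrite Rmult_1_l, <- Rpow_mult_distr.
  rewrite <- (pow1 n); apply pow_incr; split; [apply Rmult_le_pos; lra |].
  apply (Rmult_le_reg_r (1 + Cmod z)); [lra |].
  unfold r, Rdiv; rewrite !Rmult_assoc, Rinv_l; lra.
Qed.

Lemma im_le_Cmod (z : C) : Rabs (Im z) <= Cmod z.
Proof. eapply Rle_trans; [apply Rmax_r | apply Rmax_Cmod]. Qed.

Definition binom_re (d : R) (z : C) (n : nat) : R := binom_coef d n * Re (z ^ n).
Definition binom_im (d : R) (z : C) (n : nat) : R := binom_coef d n * Im (z ^ n).

Lemma binom_CV_radius d z t : 0 < d < 1 -> Cmod z < 1 -> Rabs t <= 1 ->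
  Rbar_lt (Rabs t) (CV_radius (binom_re d z)) /\ Rbar_lt (Rabs t) (CV_radius (binom_im d z)).
Proof.
intros Hd Hz Ht; split; apply (CV_radius_unit_disk _ _ z); try assumption.
- intros n; split; [apply Rlt_le, binom_coef_pos; lra | now apply binom_coef_le_1].
- intros n; apply re_le_Cmod.
- intros n; split; [apply Rlt_le, binom_coef_pos; lra | now apply binom_coef_le_1].
- intros n; apply im_le_Cmod.
Qed.

(** A recurrence between coefficients read as a first-order differential
    equation; d + n comes from the factor d plus the operator t d/dt. *)
Lemma PS_linear_ode (p q r : nat -> R) (d k1 k2 t : R) :
  (forall n, INR (S n) * p (S n) = (d + INR n) * (k1 * q n + k2 * r n)) ->
  Rbar_lt (Rabs t) (CV_radius p) ->
  Rbar_lt (Rabs t) (CV_radius q) -> Rbar_lt (Rabs t) (CV_radius r) ->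
  PSeries (PS_derive p) t
    = d * (k1 * PSeries q t + k2 * PSeries r t)
      + t * (k1 * PSeries (PS_derive q) t + k2 * PSeries (PS_derive r) t).
Proof.
intros Hrec Hp Hq Hr; apply is_pseries_unique.
assert (Sq := PSeries_correct _ _ (CV_radius_inside _ _ Hq)).
assert (Sr := PSeries_correct _ _ (CV_radius_inside _ _ Hr)).
assert (Dq := is_pseries_incr_1 _ _ _ (PSeries_correct _ _ (ex_pseries_derive _ _ Hq))).
assert (Dr := is_pseries_incr_1 _ _ _ (PSeries_correct _ _ (ex_pseries_derive _ _ Hr))).
assert (comm : forall x y : R, mult x y = mult y x) by (intros; apply Rmult_comm).
assert (L := is_pseries_plus _ _ _ _ _
  (is_pseries_plus _ _ _ _ _ (is_pseries_scal (d * k1) _ _ _ (comm _ _) Sq)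
     (is_pseries_scal (d * k2) _ _ _ (comm _ _) Sr))
  (is_pseries_plus _ _ _ _ _ (is_pseries_scal k1 _ _ _ (comm _ _) Dq)
     (is_pseries_scal k2 _ _ _ (comm _ _) Dr))).
match type of L with is_pseries _ _ ?l =>
  replace (d * (k1 * PSeries q t + k2 * PSeries r t)
      + t * (k1 * PSeries (PS_derive q) t + k2 * PSeries (PS_derive r) t)) with l end.
- apply is_pseries_ext with (2 := L); intros n.
  transitivity ((d + INR n) * (k1 * q n + k2 * r n)); [| exact (eq_sym (Hrec n))].
  unfold PS_plus, PS_scal, PS_incr_1, PS_derive, plus, scal; simpl; unfold mult; simpl.
  destruct n as [| n]; [unfold zero; simpl; ring |].
  simpl INR; ring.
- unfold plus, scal; simpl; unfold mult; simpl; ring.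
Qed.

(** With P(t) the sum of binom_coef d n z^n t^n, these are the real and imaginary
    parts of (1 - t z) P' = d z P. *)
Lemma binom_ray_ode d z t : 0 < d < 1 -> Cmod z < 1 -> Rabs t <= 1 ->
  let U := PSeries (binom_re d z) in let V := PSeries (binom_im d z) in
  let U' := PSeries (PS_derive (binom_re d z)) in
  let V' := PSeries (PS_derive (binom_im d z)) in
  U' t = d * (Re z * U t - Im z * V t) + t * (Re z * U' t - Im z * V' t) /\
  V' t = d * (Im z * U t + Re z * V t) + t * (Im z * U' t + Re z * V' t).
Proof.
intros Hd Hz Ht U V U' V'.
destruct (binom_CV_radius d z t Hd Hz Ht) as [Hre Him].
split.
- unfold U' at 1.
  rewrite (PS_linear_ode (binom_re d z) (binom_re d z) (binom_im d z) d (Re z) (- Im z) t);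
    [fold U' V' U V; ring | | assumption ..].
  intros n; unfold binom_re, binom_im; rewrite binom_coef_succ, Cpow_S.
  replace (Re (z * z ^ n)%C) with (Re z * Re (z ^ n)%C - Im z * Im (z ^ n)%C) by reflexivity.
  assert (h := pos_INR (S n)). field. apply not_0_INR; lia.
- unfold V' at 1.
  rewrite (PS_linear_ode (binom_im d z) (binom_re d z) (binom_im d z) d (Im z) (Re z) t);
    [fold U' V' U V; ring | | assumption ..].
  intros n; unfold binom_re, binom_im; rewrite binom_coef_succ, Cpow_S.
  replace (Im (z * z ^ n)%C) with (Re z * Im (z ^ n)%C + Im z * Re (z ^ n)%C) by reflexivity.
  field. apply not_0_INR; lia.
Qed.

(** The complex function U + i V solves (1 - t z) P' = d z P with P(0) = 1,
    where z = x + i y, so P times (1 - t z)^d is constant. The power is written in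
    polar form: E is its modulus and - F its argument, with no branch problem
    because 1 - t z stays in the right half-plane. W1 and W2 are the real and
    imaginary parts of the product. *)
Lemma ray_conserved (d x y : R) (U V U' V' : R -> R) :
  x < 1 ->
  (forall t, 0 <= t <= 1 -> is_derive U t (U' t) /\ is_derive V t (V' t)) ->
  (forall t, 0 <= t <= 1 ->
    U' t = d * (x * U t - y * V t) + t * (x * U' t - y * V' t) /\
    V' t = d * (y * U t + x * V t) + t * (y * U' t + x * V' t)) ->
  U 0 = 1 -> V 0 = 0 ->
  let r := exp (- d / 2 * ln ((1 - x) ^ 2 + y ^ 2)) in
  let phi := d * atan (y / (1 - x)) in
  U 1 = r * cos phi /\ V 1 = r * sin phi.
Proof.
intros Hx Hder Hode HU0 HV0 r phi.
set (D t := (1 - t * x) ^ 2 + (t * y) ^ 2).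
set (m := x ^ 2 + y ^ 2).
set (E t := exp (d / 2 * ln (D t))).
set (F t := d * atan (t * y / (1 - t * x))).
assert (Hpos : forall t, 0 <= t <= 1 -> 0 < 1 - t * x).
{ intros t Ht. destruct (Rle_lt_dec x 0) as [H | H].
  - assert (0 <= t * - x) by (apply Rmult_le_pos; lra). lra.
  - assert (t * x <= 1 * x) by (apply Rmult_le_compat_r; lra). lra. }
assert (HD : forall t, 0 <= t <= 1 -> 0 < D t).
{ intros t Ht; unfold D. assert (h := pow_lt _ 2 (Hpos t Ht)).
  assert (h2 := pow2_ge_0 (t * y)). lra. }
assert (HE : forall t, 0 <= t <= 1 -> is_derive E t (E t * (d * (- x + t * m) / D t))).
{ intros t Ht; specialize (HD t Ht). unfold E.
  evar_last.
  - apply (is_derive_comp exp (fun t => d / 2 * ln (D t))); [apply is_derive_exp |].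
    apply (is_derive_scal (fun t => ln (D t))).
    apply (is_derive_comp ln D); [now apply is_derive_ln |].
    unfold D; auto_derive; [exact I | reflexivity].
  - unfold scal; simpl; unfold mult; simpl; unfold m; field. apply Rgt_not_eq, HD. }
assert (HF : forall t, 0 <= t <= 1 -> is_derive F t (d * y / D t)).
{ intros t Ht; assert (HD' := HD t Ht); assert (Hp := Hpos t Ht). unfold F.
  auto_derive; [lra |].
  unfold D in *; field. repeat split; lra. }
set (W1 t := E t * (U t * cos (F t) + V t * sin (F t))).
set (W2 t := E t * (V t * cos (F t) - U t * sin (F t))).
(* Multiplying the equation by the conjugate of 1 - t z isolates U' and V'. *)
assert (Hsolve : forall t, 0 <= t <= 1 ->
  U' t = d * ((x - t * m) * U t - y * V t) / D t /\
  V' t = d * ((x - t * m) * V t + y * U t) / D t).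
{ intros t Ht; destruct (Hode t Ht) as [H1 H2]; specialize (HD t Ht).
  assert (e1 : U' t * (1 - t * x) + V' t * (t * y) = d * (x * U t - y * V t)) by lra.
  assert (e2 : V' t * (1 - t * x) - U' t * (t * y) = d * (y * U t + x * V t)) by lra.
  split; apply (Rmult_eq_reg_r (D t)); try lra;
    unfold Rdiv; rewrite Rmult_assoc, Rinv_l, Rmult_1_r by lra.
  - transitivity ((1 - t * x) * (U' t * (1 - t * x) + V' t * (t * y))
                   - (t * y) * (V' t * (1 - t * x) - U' t * (t * y)));
      [unfold D; ring | rewrite e1, e2; unfold m; ring].
  - transitivity ((1 - t * x) * (V' t * (1 - t * x) - U' t * (t * y))
                   + (t * y) * (U' t * (1 - t * x) + V' t * (t * y)));
      [unfold D; ring | rewrite e1, e2; unfold m; ring]. }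
assert (HW : W1 0 = W1 1 /\ W2 0 = W2 1).
{ split; apply (eq_is_derive (V := R_NormedModule)); try lra; intros t Ht;
    destruct (Hder t Ht) as [dU dV]; assert (dE := HE t Ht); assert (dF := HF t Ht);
    destruct (Hsolve t Ht) as [sU sV]; specialize (HD t Ht);
    unfold W1, W2; auto_derive;
    try (repeat split; eexists; eassumption);
    replace (Derive (fun x : R => U x) t) with (U' t) by (symmetry; apply is_derive_unique, dU);
    replace (Derive (fun x : R => V x) t) with (V' t) by (symmetry; apply is_derive_unique, dV);
    replace (Derive (fun x : R => E x) t) with (E t * (d * (- x + t * m) / D t))
      by (symmetry; apply is_derive_unique, dE);
    replace (Derive (fun x : R => F x) t) with (d * y / D t)
      by (symmetry; apply is_derive_unique, dF);
    rewrite sU, sV; unfold zero; simpl; field; lra. }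
destruct HW as [HW1 HW2].
unfold W1, W2 in HW1, HW2.
replace (F 1) with phi in HW1, HW2 by (unfold F, phi; now rewrite !Rmult_1_l).
replace (F 0) with 0 in HW1, HW2
  by (unfold F; rewrite !Rmult_0_l, Rdiv_0_l, atan_0; ring).
replace (E 0) with 1 in HW1, HW2.
2:{ unfold E, D. replace ((1 - 0 * x) ^ 2 + (0 * y) ^ 2) with 1 by ring.
    now rewrite ln_1, Rmult_0_r, exp_0. }
rewrite HU0, HV0, cos_0, sin_0 in HW1, HW2.
assert (HEr : E 1 * r = 1).
{ unfold E, D, r; rewrite !Rmult_1_l, <- exp_plus, <- exp_0; f_equal. field. }
assert (Hcs := sin2_cos2 phi); unfold Rsqr in Hcs.
assert (HE1 : 0 < E 1) by apply exp_pos.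
split; apply (Rmult_eq_reg_l (E 1)); try lra.
- transitivity (cos phi * (E 1 * (U 1 * cos phi + V 1 * sin phi))
                 - sin phi * (E 1 * (V 1 * cos phi - U 1 * sin phi))).
  + transitivity (E 1 * U 1 * (sin phi * sin phi + cos phi * cos phi));
      [rewrite Hcs; ring | ring].
  + rewrite <- HW1, <- HW2, <- (Rmult_assoc (E 1) r), HEr; ring.
- transitivity (sin phi * (E 1 * (U 1 * cos phi + V 1 * sin phi))
                 + cos phi * (E 1 * (V 1 * cos phi - U 1 * sin phi))).
  + transitivity (E 1 * V 1 * (sin phi * sin phi + cos phi * cos phi));
      [rewrite Hcs; ring | ring].
  + rewrite <- HW1, <- HW2, <- (Rmult_assoc (E 1) r), HEr; ring.
Qed.

(** The sum of the binomial series is (1 - z)^(-d); as 1 - z lies in the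
    right half-plane, its argument is less than PI d / 2 in absolute value. *)
Lemma binom_series_polar d z : 0 < d < 1 -> Cmod z < 1 ->
  exists phi, Rabs phi < PI * d / 2 /\
    is_series (V := C_NormedModule) (fun n => (RtoC (binom_coef d n) * z ^ n)%C)
      (Rpower (Cmod (1 - z)) (- d) * cos phi, Rpower (Cmod (1 - z)) (- d) * sin phi).
Proof.
intros Hd Hz.
assert (Hx : Re z < 1).
{ apply Rle_lt_trans with (Cmod z); [| exact Hz].
  eapply Rle_trans; [apply Rle_abs | apply re_le_Cmod]. }
assert (Hunit : forall t, 0 <= t <= 1 -> Rabs t <= 1)
  by (intros; rewrite Rabs_right; lra).
destruct (ray_conserved d (Re z) (Im z)
  (PSeries (binom_re d z)) (PSeries (binom_im d z))
  (PSeries (PS_derive (binom_re d z))) (PSeries (PS_derive (binom_im d z)))) as [HU HV].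
- exact Hx.
- intros t Ht; destruct (binom_CV_radius d z t Hd Hz (Hunit t Ht)).
  split; now apply is_derive_PSeries.
- intros t Ht; apply binom_ray_ode; auto.
- rewrite PSeries_0; unfold binom_re, binom_coef; simpl; field.
- rewrite PSeries_0; unfold binom_im, binom_coef; simpl; field.
- exists (d * atan (Im z / (1 - Re z))); split.
  + rewrite Rabs_mult, Rabs_right by lra.
    assert (Ha := atan_bound (Im z / (1 - Re z))).
    replace (PI * d / 2) with (d * (PI / 2)) by field.
    apply Rmult_lt_compat_l; [lra | apply Rabs_def1; lra].
  + assert (Hmod : exp (- d / 2 * ln ((1 - Re z) ^ 2 + Im z ^ 2)) = Rpower (Cmod (1 - z)) (- d)).
    { unfold Rpower; f_equal.
      assert (Hsq : (1 - Re z) ^ 2 + Im z ^ 2 = Cmod (1 - z) ^ 2).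
      { rewrite Cmod2_alt; destruct z as [x y]; simpl; ring. }
      rewrite Hsq, ln_pow; [simpl; field |].
      apply Cmod_gt_0; intros H0; apply (f_equal Re) in H0.
      destruct z as [x y]; simpl in *; lra. }
    rewrite Hmod in HU, HV.
    assert (H1 : Rabs 1 <= 1) by (rewrite Rabs_R1; lra).
    destruct (binom_CV_radius d z 1 Hd Hz H1) as [Cre Cim].
    assert (Sre := PSeries_correct _ _ (CV_radius_inside _ _ Cre)).
    assert (Sim := PSeries_correct _ _ (CV_radius_inside _ _ Cim)).
    rewrite HU in Sre; rewrite HV in Sim.
    apply is_series_C.
    * apply is_series_ext with (2 := Sre); intros n.
      rewrite pow_n_pow, pow1, re_scal_l; apply Rmult_1_l.
    * apply is_series_ext with (2 := Sim); intros n.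
      rewrite pow_n_pow, pow1, im_scal_l; apply Rmult_1_l.
Qed.

(** * Images of the disk *)

Lemma abs_summable_series_C (h : nat -> R) (M : R) (z : C) :
  (forall N, sum_f_R0 (fun n => Rabs (h n)) N <= M) -> Cmod z <= 1 ->
  exists H : C, Cmod H <= M /\ is_series (V := C_NormedModule) (fun n => (RtoC (h n) * z ^ n)%C) H.
Proof.
intros HM Hz.
assert (Hterm : forall n, Cmod (RtoC (h n) * z ^ n)%C <= Rabs (h n)).
{ intros n; rewrite Cmod_mult, Cmod_R, Cmod_pow.
  rewrite <- (Rmult_1_r (Rabs (h n))) at 2.
  apply Rmult_le_compat_l; [apply Rabs_pos |].
  rewrite <- (pow1 n); apply pow_incr; split; [apply Cmod_ge_0 | exact Hz]. }
assert (Hex : ex_series (V := C_CompleteNormedModule) (fun n => (RtoC (h n) * z ^ n)%C)).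
{ apply (ex_series_le (V := C_CompleteNormedModule) _ (fun n => Rabs (h n)));
    [exact Hterm |].
  destruct (ex_finite_lim_seq_incr (sum_n (fun n => Rabs (h n))) M) as [l Hl].
  - intros n; rewrite sum_Sn; unfold plus; simpl.
    assert (p := Rabs_pos (h (S n))). lra.
  - intros n; rewrite sum_n_Reals; apply HM.
  - now exists l. }
destruct Hex as [H HH]; exists H; split; [| exact HH].
assert (Hnorm : filterlim (fun N => Cmod (sum_n (G := C_NormedModule)
  (fun n => (RtoC (h n) * z ^ n)%C) N)) eventually (locally (Cmod H))).
{ refine (filterlim_comp _ _ _ _ (@norm _ C_NormedModule) _ _ _ HH _).
  apply (filterlim_norm (V := C_NormedModule)). }
refine (is_lim_seq_le _ (fun _ => M) (Finite _) (Finite _) _ Hnorm (is_lim_seq_const M)).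
intros N; eapply Rle_trans; [| apply (HM N)].
rewrite <- sum_n_Reals; induction N as [| N IH]; [rewrite !sum_O; apply Hterm |].
rewrite !sum_Sn. eapply Rle_trans; [apply Cmod_triangle |].
apply Rplus_le_compat; [exact IH | apply Hterm].
Qed.

Definition polar (r phi : R) : C := (r * cos phi, r * sin phi).

Lemma Cmod_polar r phi : 0 <= r -> Cmod (polar r phi) = r.
Proof.
intros Hr; unfold Cmod, polar; simpl fst; simpl snd.
replace ((r * cos phi) ^ 2 + (r * sin phi) ^ 2) with (r ^ 2).
- now apply sqrt_pow2.
- assert (h := sin2_cos2 phi); unfold Rsqr in h.
  transitivity (r ^ 2 * (sin phi * sin phi + cos phi * cos phi)); [rewrite h | ]; ring.
Qed.

Lemma sector_polar d r phi : d < 1 -> 0 < r -> Rabs phi < PI * d / 2 -> sector d (polar r phi).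
Proof.
intros Hd Hr Hphi.
assert (hpi := PI_RGT_0).
split.
- apply Cmod_gt_0; rewrite Cmod_polar; lra.
- assert (Hc : acos (Re (polar r phi) / Cmod (polar r phi)) = Rabs phi).
  { rewrite Cmod_polar by lra. unfold polar; simpl.
    replace (r * cos phi / r) with (cos phi) by (field; lra).
    replace (cos phi) with (cos (Rabs phi)).
    - apply acos_cos; split; [apply Rabs_pos |].
      assert (PI * d < PI * 1) by (apply Rmult_lt_compat_l; lra). lra.
    - unfold Rabs; destruct Rcase_abs; [apply cos_neg | reflexivity]. }
  unfold Carg; rewrite Hc.
  destruct Rle_dec; [| rewrite Rabs_Ropp]; now rewrite Rabs_Rabsolu.
Qed.

(** The hypergeometric function is its singular part B (1 - z)^(-d) plus a
    remainder bounded on the disk. *)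
Lemma hyp2F1_decomposition a b c d B M z :
  0 < d < 1 ->
  (forall N, sum_f_R0 (fun n => Rabs (hyp_coef a b c n - B * binom_coef d n)) N <= M) ->
  Cmod z < 1 ->
  exists (H : C) (phi : R), Cmod H <= M /\ Rabs phi < PI * d / 2 /\
    hyp2F1 a b c z = (H + B * polar (Rpower (Cmod (1 - z)) (- d)) phi)%C.
Proof.
intros Hd HM Hz.
destruct (abs_summable_series_C _ M z HM (Rlt_le _ _ Hz)) as (H & HH & SH).
destruct (binom_series_polar d z Hd Hz) as (phi & Hphi & SP).
exists H, phi; split; [exact HH | split; [exact Hphi |]].
assert (SF := is_series_plus _ _ _ _ SH (is_series_scal_l (RtoC B) _ _ SP)).
apply is_series_ext with
  (b := fun n => (RtoC (pochhammer a n * pochhammer b n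
                         / (pochhammer c n * INR (fact n))) * z ^ n)%C) in SF.
- apply (iota_unique (V := C_CompleteNormedModule)); [| exact SF].
  intros y Hy; exact (filterlim_locally_unique (V := C_NormedModule) _ _ _ Hy SF).
- intros n.
  change ((RtoC (hyp_coef a b c n - B * binom_coef d n) * z ^ n
            + RtoC B * (RtoC (binom_coef d n) * z ^ n))%C
           = (RtoC (hyp_coef a b c n) * z ^ n)%C).
  rewrite RtoC_minus, RtoC_mult; ring.
Qed.

(** Here H is the remainder and B P the singular part; the difference is
    z H - B (1 - z) P, where the factor 1 - z tames the singularity. *)
Lemma near_scaled_main_term (z H P : C) (B M X : R) :
  Cmod z < 1 -> Cmod H <= M -> 0 < B -> Cmod (1 - z) * Cmod P < X ->
  Cmod (z * (H + B * P) - B * P)%C < M + X * B.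
Proof.
intros Hz HH HB HX.
replace (z * (H + B * P) - B * P)%C with (z * H + - (B * ((1 - z) * P)))%C by ring.
eapply Rle_lt_trans; [apply Cmod_triangle |].
rewrite Cmod_opp, !Cmod_mult, Cmod_R, (Rabs_right B) by lra.
apply Rplus_le_lt_compat.
- rewrite <- (Rmult_1_l M); apply Rmult_le_compat; try apply Cmod_ge_0; lra.
- rewrite (Rmult_comm X); now apply Rmult_lt_compat_l.
Qed.

Lemma Cmod_one_minus_bounds z : Cmod z < 1 -> 0 < Cmod (1 - z) < 2.
Proof.
intros Hz; split.
- assert (H := Cmod_triangle (1 - z) z).
  replace (1 - z + z)%C with (RtoC 1) in H by ring. rewrite Cmod_1 in H; lra.
- assert (H := Cmod_triangle 1 (- z)); rewrite Cmod_opp, Cmod_1 in H.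
  unfold Cminus; lra.
Qed.

Lemma one_minus_mul_power_lt d z : 0 < d < 1 -> Cmod z < 1 ->
  Cmod (1 - z) * Rpower (Cmod (1 - z)) (- d) < Rpower 2 (1 - d).
Proof.
intros Hd Hz; assert (H := Cmod_one_minus_bounds z Hz).
rewrite <- (Rpower_1 (Cmod (1 - z))) at 1 by lra.
rewrite <- Rpower_plus; apply Rlt_Rpower_l; lra.
Qed.

Lemma Cmod_sqr_lt_1 z : Cmod z < 1 -> Cmod (z ^ 2) < 1.
Proof.
intros Hz; rewrite Cmod_pow; simpl; rewrite Rmult_1_r.
assert (h := Cmod_ge_0 z).
apply Rle_lt_trans with (Cmod z * 1); [apply Rmult_le_compat_l |]; lra.
Qed.

(** In the right half of the disk |1 + z| >= 1, so |1 - z^2| >= |1 - z|. *)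
Lemma one_minus_mul_power_sqr_lt d z : 0 < d < 1 -> Cmod z < 1 -> 0 <= Re z ->
  Cmod (1 - z) * Rpower (Cmod (1 - z ^ 2)) (- d) < Rpower 2 (1 - d).
Proof.
intros Hd Hz Hre; assert (H := Cmod_one_minus_bounds z Hz).
eapply Rle_lt_trans; [| now apply (one_minus_mul_power_lt d z)].
apply Rmult_le_compat_l; [lra |].
rewrite !Rpower_Ropp; apply Rinv_le_contravar; [apply exp_pos |].
apply Rle_Rpower_l; [lra | split; [lra |]].
replace (1 - z ^ 2)%C with ((1 - z) * (1 + z))%C by (simpl; ring).
rewrite Cmod_mult, <- (Rmult_1_r (Cmod (1 - z))) at 1.
apply Rmult_le_compat_l; [lra |].
apply Rle_trans with (Rabs (Re (1 + z))); [| apply re_le_Cmod].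
destruct z as [x y]; simpl in *; rewrite Rabs_right; lra.
Qed.

(** The point of the sector near the image of z is B (1 - z)^(-d) in the first
    part and, in the second, B (1 - z^2)^(-d) or its opposite according to the
    sign of Re z; the case Re z < 0 is the other one at - z. *)
Lemma nbhd_sectors_of_remainder a b c d B M :
  0 < d < 1 -> 0 < B ->
  (forall N, sum_f_R0 (fun n => Rabs (hyp_coef a b c n - B * binom_coef d n)) N <= M) ->
  subset (image (fun z : C => (z * hyp2F1 a b c z)%C) unit_disk)
         (nbhd (M + Rpower 2 (1 - d) * B) (sector d)) /\
  subset (image (fun z : C => (z * hyp2F1 a b c (z ^ 2))%C) unit_disk)
         (nbhd (M + Rpower 2 (1 - d) * B) (double_sector d)).
Proof.
intros Hd HB HM.
assert (Hsec : forall r phi, 0 < r -> Rabs phi < PI * d / 2 -> sector d (B * polar r phi)%C).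
{ intros r phi Hr Hphi.
  replace (B * polar r phi)%C with (polar (B * r) phi).
  - apply sector_polar; [lra | now apply Rmult_lt_0_compat | exact Hphi].
  - unfold polar, Cmult, RtoC; simpl; f_equal; ring. }
assert (Hr : forall w, 0 < Rpower (Cmod (1 - w)) (- d)) by (intros; apply exp_pos).
split; intros w (z & Hz & ->); unfold unit_disk in Hz.
- destruct (hyp2F1_decomposition a b c d B M z Hd HM Hz) as (H & phi & HH & Hphi & ->).
  exists (B * polar (Rpower (Cmod (1 - z)) (- d)) phi)%C; split; [now apply Hsec |].
  apply near_scaled_main_term; try assumption.
  rewrite Cmod_polar by apply Rlt_le, Hr. now apply one_minus_mul_power_lt.
- destruct (hyp2F1_decomposition a b c d B M (z ^ 2) Hd HM (Cmod_sqr_lt_1 z Hz))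
    as (H & phi & HH & Hphi & ->).
  set (P := polar (Rpower (Cmod (1 - z ^ 2)) (- d)) phi).
  assert (HP : Cmod P = Rpower (Cmod (1 - z ^ 2)) (- d))
    by (apply Cmod_polar, Rlt_le, Hr).
  destruct (Rle_lt_dec 0 (Re z)) as [Hre | Hre].
  + exists (B * P)%C; split; [left; now apply Hsec |].
    apply near_scaled_main_term; try assumption.
    rewrite HP; now apply one_minus_mul_power_sqr_lt.
  + exists (- (B * P))%C; split.
    { right; replace (- - (B * P))%C with (B * P)%C by ring; now apply Hsec. }
    replace (z * (H + B * P) - - (B * P))%C with (- ((- z) * (H + B * P) - B * P))%C by ring.
    rewrite Cmod_opp; apply near_scaled_main_term; try assumption.
    * now rewrite Cmod_opp.
    * rewrite HP; replace (z ^ 2)%C with ((- z) ^ 2)%C by (simpl; ring).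
      apply one_minus_mul_power_sqr_lt; [exact Hd | now rewrite Cmod_opp |].
      destruct z as [x y]; simpl in *; lra.
Qed.

(** When c = a or c = b the hypergeometric function is (1 - z)^(-d) itself. *)
Lemma hyp_coef_remainder_sum_degenerate a b c d :
  0 < a -> 0 < b -> 0 < c -> 0 < d < 1 -> d = a + b - c -> (c = a \/ c = b) ->
  forall N, sum_f_R0 (fun n => Rabs (hyp_coef a b c n - 1 * binom_coef d n)) N <= 0.
Proof.
intros Ha Hb Hc Hd Heq Hcab N; right.
rewrite (sum_eq _ (fun _ => 0)); [apply sum_eq_R0; reflexivity |].
intros n _; rewrite (hyp_coef_eq_ratio a b c d n) by lra.
assert (hc := pochhammer_pos c n Hc). assert (hd := pochhammer_pos d n (proj1 Hd)).
replace (coef_ratio a b c d n) with 1; [rewrite <- Rabs_R0; f_equal; ring |].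
unfold coef_ratio; destruct Hcab as [e | e].
- replace b with d by lra; rewrite <- e; field; lra.
- replace a with d by lra; rewrite <- e; field; lra.
Qed.

Theorem theorem1p2 :
  forall a b c delta epsilon : R,
    0 < a -> 0 < b -> 0 < c -> a <= b ->
    delta = a + b - c -> 0 < delta < 1 ->
    epsilon = eps_const a b c ->
    subset (image (fun z : C => (z * hyp2F1 a b c z)%C) unit_disk)
           (nbhd epsilon (sector delta))
    /\
    subset (image (fun z : C => (z * hyp2F1 a b c (z ^ 2))%C) unit_disk)
           (nbhd epsilon (double_sector delta)).
Proof.
intros a b c d eps Ha Hb Hc _ Heq Hd ->.
assert (Hdeg : (c = a \/ c = b) -> eps_const a b c = 0 + Rpower 2 (1 - d) * 1).
{ intros Hcab; unfold eps_const; rewrite <- Heq.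
  destruct (Req_EM_T c a); [ring |]. destruct (Req_EM_T c b); [ring | tauto]. }
destruct (Req_EM_T c a) as [e | Hca];
  [| destruct (Req_EM_T c b) as [e | Hcb]].
- rewrite Hdeg by auto; apply nbhd_sectors_of_remainder; [exact Hd | lra |].
  apply hyp_coef_remainder_sum_degenerate; auto.
- rewrite Hdeg by auto; apply nbhd_sectors_of_remainder; [exact Hd | lra |].
  apply hyp_coef_remainder_sum_degenerate; auto.
- assert (Hd0 : 0 < d) by lra.
  assert (G0 := fun x => Gamma_integral_pos x).
  set (G := Gamma_integral (c + 1) * Gamma_integral (c + 1 - a - b)
              / (Gamma_integral (c + 1 - a) * Gamma_integral (c + 1 - b))).
  set (B := Gamma_integral c * Gamma_integral d / (Gamma_integral a * Gamma_integral b)).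
  assert (HG : 0 < G) by
    (apply Rdiv_lt_0_compat; apply Rmult_lt_0_compat; apply G0; lra).
  assert (HB : 0 < B) by
    (apply Rdiv_lt_0_compat; apply Rmult_lt_0_compat; apply G0; lra).
  assert (Heps : eps_const a b c
                  = Rabs ((a - d) * (b - d) / (c * d)) * G + Rpower 2 (1 - d) * B).
  { unfold eps_const.
    destruct (Req_EM_T c a) as [? | _]; [contradiction |].
    destruct (Req_EM_T c b) as [? | _]; [contradiction |].
    rewrite <- Heq. f_equal.
    - rewrite (Gamma_eq_integral c Hc), (Gamma_eq_integral_succ (- d)),
        (Gamma_eq_integral_succ (c - a)), (Gamma_eq_integral_succ (c - b)) by lra.
      rewrite <- (Rabs_right G), <- Rabs_mult by lra.
      rewrite <- Rabs_Ropp; f_equal. unfold G.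
      rewrite (Gamma_integral_succ c Hc).
      replace (c + 1 - a - b) with (- d + 1) by lra.
      replace (c + 1 - a) with (c - a + 1) by lra.
      replace (c + 1 - b) with (c - b + 1) by lra.
      replace (a - d) with (c - b) by lra; replace (b - d) with (c - a) by lra.
      assert (g1 := G0 (c - a + 1) ltac:(lra)). assert (g2 := G0 (c - b + 1) ltac:(lra)).
      field; repeat split; lra.
    - rewrite !Gamma_eq_integral by lra; reflexivity. }
  rewrite Heps; apply nbhd_sectors_of_remainder; [exact Hd | exact HB |].
  apply hyp_coef_remainder_sum; try assumption.
  + apply pochhammer_ratio_lim; lra.
  + intros N; apply Gauss_sum_le; lra.
Qed.
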